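(* Let $k\ge 2$, let $n_1,\dots,n_k\ge 1$, $n=n_1+\cdots+n_k$, and let \[A=\begin{bmatrix} 0 & A_1 & & \\ & 0 & \ddots & \\ & & \ddots & A_{k-1} \\ & & & 0\end{bmatrix}\quad\text{on } \mathbb{C}^n=\mathbb{C}^{n_1}\oplus\cdots\oplus\mathbb{C}^{n_k}\] be an $n$-by-$n$ block shift, where $A_j$ is a complex $n_j$-by-$n_{j+1}$ matrix for $1\le j\le k-1$. Let \[A''=\begin{bmatrix} 0 & m(A_1) & & \\ & 0 & \ddots & \\ & & \ddots & m(A_{k-1}) \\ & & & 0\end{bmatrix}\quad\text{on } \mathbb{C}^k.\] Then: (a) $w(A)\ge w(A'')$; (b) under the assumption that $A_1A_2\cdots A_{k-1}\ne 0$, $w(A)=w(A'')$ if and only if $A$ is unitarily similar to $A''\oplus C$, where $C$ is a block shift with $w(C)\le w(A'')$.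
   Context: The minimum modulus of a complex $p$-by-$q$ matrix $B$ is $m(B)=\min\{\|Bx\| : x\in\mathbb{C}^q,\ \|x\|=1\}$ (Euclidean norms). The numerical radius of a square complex matrix $B$ of size $n$ is $w(B)=\max\{|\langle Bx,x\rangle| : x\in\mathbb{C}^n,\ \|x\|=1\}$. A block shift is a square complex matrix which, with respect to some decomposition $\mathbb{C}^{m_1}\oplus\cdots\oplus\mathbb{C}^{m_l}$ of the underlying space ($l\ge 1$), has the block form with (in general rectangular) matrices $B_1,\dots,B_{l-1}$ on the first block superdiagonal, $B_j$ of size $m_j$-by-$m_{j+1}$, and zero blocks elsewhere (in particular, zero diagonal blocks). The number and sizes of the blocks of the block shift $C$ need not be those of $A$, and the summand $C$ is allowed to be absent (to act on a $0$-dimensional space), in which case the condition $w(C)\le w(A'')$ is vacuous. *)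

(* Defs.v *)
From HB Require Import structures.
From mathcomp Require Import all_boot all_order all_algebra.
From mathcomp Require Import spectral.
From mathcomp Require Import boolp classical_sets reals.
From mathcomp Require Export complex.

Set Implicit Arguments.
Unset Strict Implicit.
Unset Printing Implicit Defensive.

Import Order.TTheory GRing.Theory Num.Theory.
Local Open Scope ring_scope.
Local Open Scope classical_set_scope.

Definition inner (R : realType) n (x y : 'cV[R[i]]_n) : R[i] :=
  \sum_(i < n) x i 0 * (y i 0)^*.

Definition euclid_norm (R : realType) n (x : 'cV[R[i]]_n) : R :=
  Num.sqrt (\sum_(i < n) Normc.normc (x i 0) ^+ 2).

(* By compactness of the unit sphere this infimum is a minimum whenever
   [0 < q]; for [q = 0] its value is the convention [inf set0 = 0]. *)
Definition min_modulus (R : realType) p q (B : 'M[R[i]]_(p, q)) : R :=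
  inf [set euclid_norm (B *m x) | x in [set x : 'cV[R[i]]_q | euclid_norm x = 1]].

(* Likewise a maximum whenever [0 < n]. *)
Definition numerical_radius (R : realType) n (B : 'M[R[i]]_n) : R :=
  sup [set Normc.normc (inner (B *m x) x)
      | x in [set x : 'cV[R[i]]_n | euclid_norm x = 1]].

(* Blocks are numbered from 0: with [l] block rows, only the sizes
   [m_ 0, ..., m_ l.-1] and the matrices [B 0, ..., B l.-2] are used.
   When [j = i.+1] the sizes in [conform_mx] agree, so that the block at
   [(i, j)] is [B i] transported to type ['M_(m_ i, m_ j)]. *)
Definition block_shift (R : realType) (l : nat) (m_ : nat -> nat)
    (B : forall j : nat, 'M[R[i]]_(m_ j, m_ j.+1)) :
    'M[R[i]]_(\sum_(i < l) m_ i) :=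
  \mxblock_(i < l, j < l)
    (if j == i.+1 :> nat then conform_mx (0 : 'M_(m_ i, m_ j)) (B i) else 0).

Definition weighted_shift (R : realType) (k : nat) (a : nat -> R) : 'M[R[i]]_k :=
  \matrix_(i < k, j < k) (if j == i.+1 :> nat then (a i)%:C%C else 0).

(* [B 0 *m B 1 *m ... *m B l.-1] *)
Fixpoint chain_prod (R : realType) (m_ : nat -> nat)
    (B : forall j : nat, 'M[R[i]]_(m_ j, m_ j.+1)) (l : nat) :
    'M[R[i]]_(m_ 0%N, m_ l) :=
  if l is l'.+1 then chain_prod B l' *m B l' else 1%:M.

(* The equation between dimensions is part of the assertion. *)
Definition unitarily_similar (R : realType) p q
    (M : 'M[R[i]]_p) (N : 'M[R[i]]_q) : Prop :=
  exists (e : p = q) (U : 'M[R[i]]_q),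
    U \is unitarymx /\ castmx (e, e) M = map_mx Num.conj U^T *m N *m U.

Definition dsum_mx (R : realType) p q
    (M : 'M[R[i]]_p) (N : 'M[R[i]]_q) : 'M[R[i]]_(p + q) :=
  block_mx M 0 0 N.

(* Main.v *)
(* Let y >= 0 be a unit vector maximizing the quadratic form of A''.  Starting
   from a unit vector u_k of the last summand and putting
   u_i = A u_(i+1) / |A u_(i+1)|, one gets A u_(i+1) = b_i u_i with
   b_i >= m(A_i), so z = sum_i y_i u_i is a unit vector with
   <A z, z> = sum_i b_i y_i y_(i+1) >= w(A''); this is (a).
   If A_1 ... A_(k-1) <> 0, then u_k can be chosen with all b_i > 0, and if
   moreover w(A) = w(A''), then z maximizes Re <A x, x>, so it satisfies
   A z + A^* z = 2 w(A) z.  Read on each summand, this equation forces y_i > 0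
   for all i, hence b_i = m(A_i), and it says that A^* u_i is a multiple of
   u_(i+1): the u_i span a reducing subspace on which A acts as A'', and on the
   orthogonal complement, graded by the complements of the u_i, A is a block
   shift. *)

Require Import Defs.
From mathcomp Require Import all_boot all_order all_algebra.
From mathcomp Require Import spectral ring lra.
From mathcomp Require Import boolp classical_sets reals topology normedtype derive.

Set Implicit Arguments.
Unset Strict Implicit.
Unset Printing Implicit Defensive.

Import Order.TTheory GRing.Theory Num.Theory.
Import tagnat.
Local Open Scope ring_scope.

(** * Inner products and the numerical radius *)

Section Inner.
Variable R : realType.
Local Notation C := R[i].

Lemma normc_ge0 (z : C) : 0 <= Normc.normc z.
Proof. by case: z => a b; exact: sqrtr_ge0. Qed.

Lemma conjC_real (a : R) : ((a%:C%C : C)^*) = a%:C%C.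
Proof. exact: conjc_real. Qed.

Lemma mulCJ_normc (z : C) : z * z^* = (Normc.normc z ^+ 2)%:C%C.
Proof. by rewrite -normCK rmorphXn. Qed.

Lemma normc_real (a : R) : Normc.normc (a%:C%C : C) = `|a|.
Proof. by rewrite /Normc.normc /= expr0n addr0 sqrtr_sqr. Qed.

Lemma Re_le_normc (z : C) : complex.Re z <= Normc.normc z.
Proof.
have := normc_ge_Re z; rewrite lecR; apply: le_trans; exact: ler_norm.
Qed.

Lemma normc_eq0 (z : C) : (Normc.normc z == 0) = (z == 0).
Proof.
apply/eqP/eqP => [|->]; first exact: Normc.eq0_normc.
exact: (Normc.normc0 R).
Qed.

Lemma normc_conj (z : C) : Normc.normc (z^*) = Normc.normc z.
Proof. by apply: complexI; exact: norm_conjC. Qed.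

Lemma normc_sum (I : Type) (r : seq I) (P : pred I) (F : I -> C) :
  Normc.normc (\sum_(i <- r | P i) F i) <= \sum_(i <- r | P i) Normc.normc (F i).
Proof.
have := ler_norm_sum r F P; rewrite -lecR => h.
apply: le_trans h _; rewrite le_eqVlt; apply/orP; left; apply/eqP.
by rewrite rmorph_sum.
Qed.

Lemma innerDl n (x y z : 'cV[C]_n) : inner (x + y) z = inner x z + inner y z.
Proof. by rewrite -big_split; apply: eq_bigr => i _; rewrite mxE mulrDl. Qed.

Lemma innerZl n (a : C) (x z : 'cV[C]_n) : inner (a *: x) z = a * inner x z.
Proof. by rewrite big_distrr; apply: eq_bigr => i _; rewrite mxE -mulrA. Qed.

Lemma innerC n (x y : 'cV[C]_n) : inner x y = (inner y x)^*.
Proof.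
rewrite rmorph_sum; apply: eq_bigr => i _.
by rewrite rmorphM /= conjCK mulrC.
Qed.

Lemma innerDr n (x y z : 'cV[C]_n) : inner x (y + z) = inner x y + inner x z.
Proof. by rewrite innerC innerDl rmorphD /= -!innerC. Qed.

Lemma innerZr n (a : C) (x z : 'cV[C]_n) : inner x (a *: z) = a^* * inner x z.
Proof. by rewrite innerC innerZl rmorphM /= -innerC. Qed.

Lemma inner0l n (x : 'cV[C]_n) : inner 0 x = 0.
Proof. by rewrite /inner big1 // => i _; rewrite mxE mul0r. Qed.

Lemma inner0r n (x : 'cV[C]_n) : inner x 0 = 0.
Proof. by rewrite innerC inner0l conjC0. Qed.

Lemma inner_suml n (I : Type) (r : seq I) (P : pred I) (F : I -> 'cV[C]_n) y :
  inner (\sum_(i <- r | P i) F i) y = \sum_(i <- r | P i) inner (F i) y.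
Proof.
by elim/big_rec2: _ => [|i a b _ <-]; rewrite ?inner0l ?innerDl.
Qed.

Lemma inner_sumr n (I : Type) (r : seq I) (P : pred I) (F : I -> 'cV[C]_n) y :
  inner y (\sum_(i <- r | P i) F i) = \sum_(i <- r | P i) inner y (F i).
Proof.
by elim/big_rec2: _ => [|i a b _ <-]; rewrite ?inner0r ?innerDr.
Qed.

Lemma inner_mulmx n (x y : 'cV[C]_n) :
  inner x y = ((map_mx Num.conj y^T) *m x) 0 0.
Proof. by rewrite mxE; apply: eq_bigr => i _; rewrite !mxE mulrC. Qed.

Lemma inner_adj m n (M : 'M[C]_(m, n)) x y :
  inner (M *m x) y = inner x (map_mx Num.conj M^T *m y).
Proof.
have MK : map_mx Num.conj (map_mx Num.conj M^T)^T = M.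
  by apply/matrixP => i j; rewrite !mxE; exact: conjCK.
by rewrite !inner_mulmx trmx_mul map_mxM MK mulmxA.
Qed.

Lemma euclid_norm_ge0 n (x : 'cV[C]_n) : 0 <= euclid_norm x.
Proof. exact: sqrtr_ge0. Qed.

Lemma euclid_norm_sqr n (x : 'cV[C]_n) :
  euclid_norm x ^+ 2 = \sum_(i < n) Normc.normc (x i 0) ^+ 2.
Proof. by rewrite sqr_sqrtr // sumr_ge0 // => i _; rewrite sqr_ge0. Qed.

Lemma inner_sqnorm n (x : 'cV[C]_n) : inner x x = (euclid_norm x ^+ 2)%:C%C.
Proof.
by rewrite euclid_norm_sqr rmorph_sum; apply: eq_bigr => i _; rewrite mulCJ_normc.
Qed.

Lemma euclid_norm_unit n (x : 'cV[C]_n) : inner x x = 1 <-> euclid_norm x = 1.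
Proof.
rewrite inner_sqnorm; split => [|->]; last by rewrite expr1n.
move/complexI/eqP; rewrite sqrp_eq1 ?euclid_norm_ge0 //.
by move/eqP.
Qed.

Lemma euclid_norm_eq0 n (x : 'cV[C]_n) : (euclid_norm x == 0) = (x == 0).
Proof.
rewrite -sqrf_eq0 euclid_norm_sqr; apply/eqP/eqP => [/psumr_eq0P h|->].
  apply/colP => i; rewrite mxE; apply/eqP.
  by rewrite -normc_eq0 -sqrf_eq0 h // => k _; exact: sqr_ge0.
by rewrite big1 // => i _; rewrite mxE (Normc.normc0 R) expr0n.
Qed.

Lemma euclid_norm0 n : euclid_norm (0 : 'cV[C]_n) = 0.
Proof. by apply/eqP; rewrite euclid_norm_eq0. Qed.

Lemma inner_eq0 n (x : 'cV[C]_n) : (inner x x == 0) = (x == 0).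
Proof.
rewrite inner_sqnorm -euclid_norm_eq0 -[RHS]sqrf_eq0.
by rewrite -(inj_eq (@complexI R)).
Qed.

Lemma euclid_normZ n (a : C) (x : 'cV[C]_n) :
  euclid_norm (a *: x) = Normc.normc a * euclid_norm x.
Proof.
apply/eqP; rewrite -(@eqrXn2 _ 2) ?mulr_ge0 ?euclid_norm_ge0 ?normc_ge0 //.
apply/eqP; apply: complexI; rewrite -inner_sqnorm innerZl innerZr mulrA mulCJ_normc.
rewrite inner_sqnorm exprMn; exact/esym/rmorphM.
Qed.

Lemma euclid_norm_normalize n (x : 'cV[C]_n) :
  x != 0 -> euclid_norm ((euclid_norm x)^-1%:C%C *: x) = 1.
Proof.
rewrite -euclid_norm_eq0 => x0.
by rewrite euclid_normZ normc_real ger0_norm ?invr_ge0 ?euclid_norm_ge0 // mulVf.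
Qed.

Lemma euclid_norm_delta n (s : 'I_n) :
  euclid_norm (delta_mx s 0 : 'cV[C]_n) = 1.
Proof.
apply/euclid_norm_unit; rewrite /inner (bigD1 s) //= big1 => [|i /negPf nis].
  by rewrite !mxE !eqxx conjC1 mulr1 addr0.
by rewrite !mxE nis mul0r.
Qed.

Lemma inner_deltal n (s : 'I_n) (x : 'cV[C]_n) :
  inner (delta_mx s 0) x = (x s 0)^*.
Proof.
rewrite /inner (bigD1 s) //= big1 => [|i /negPf nis].
  by rewrite !mxE !eqxx mul1r addr0.
by rewrite !mxE nis mul0r.
Qed.

Lemma inner_deltar n (s : 'I_n) (x : 'cV[C]_n) :
  inner x (delta_mx s 0) = x s 0.
Proof. by rewrite innerC inner_deltal conjCK. Qed.

End Inner.

Section NumericalRadius.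
Variable R : realType.
Local Notation C := R[i].
Local Open Scope classical_set_scope.

Lemma normc_coord_le1 n (x : 'cV[C]_n) i :
  euclid_norm x = 1 -> Normc.normc (x i 0) <= 1.
Proof.
move=> x1; rewrite -(@ler_pXn2r _ 2) ?nnegrE ?normc_ge0 //.
rewrite -[leRHS](congr1 (fun r => r ^+ 2) x1) euclid_norm_sqr (bigD1 i) //=.
rewrite lerDl sumr_ge0 // => j _.
exact: sqr_ge0.
Qed.

(** Coordinates of a unit vector have modulus at most 1, so the sum of the moduli of all entries is
    a bound. Boundedness is what gives the [sup] its meaning. *)
Lemma numerical_radius_has_ubound n (B : 'M[C]_n) :
  has_ubound [set Normc.normc (inner (B *m x) x)
             | x in [set x : 'cV[C]_n | euclid_norm x = 1]].
Proof.
exists (\sum_i \sum_j Normc.normc (B i j)) => _ [x x1 <-].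
rewrite (le_trans (normc_sum _ _ _)) //; apply: ler_sum => i _.
rewrite Normc.normcM mxE.
rewrite (@le_trans _ _ (Normc.normc (\sum_j B i j * x j 0))) //.
  by rewrite ler_piMr ?normc_ge0 // normc_conj normc_coord_le1.
rewrite (le_trans (normc_sum _ _ _)) //; apply: ler_sum => j _.
by rewrite Normc.normcM ler_piMr ?normc_ge0 // normc_coord_le1.
Qed.

Lemma numerical_radius_unit n (B : 'M[C]_n) x :
  euclid_norm x = 1 -> Normc.normc (inner (B *m x) x) <= numerical_radius B.
Proof.
by move=> x1; apply: ub_le_sup; [exact: numerical_radius_has_ubound|exists x].
Qed.

Lemma numerical_radius_ge0 n (B : 'M[C]_n) : 0 <= numerical_radius B.
Proof.
case: n => [|n] in B *.
  (* In dimension 0 there is no unit vector, and the supremum takes its default value 0. *)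
  rewrite /numerical_radius (_ : [set _ | _ in _] = set0) ?sup0 //.
  apply/seteqP; split=> // r [x /= + _].
  rewrite /euclid_norm big_ord0 sqrtr0 => /esym /eqP.
  by rewrite oner_eq0.
apply: le_trans (numerical_radius_unit B (euclid_norm_delta R ord0)).
exact: normc_ge0.
Qed.

Lemma numerical_radius_ub n (B : 'M[C]_n) x :
  Normc.normc (inner (B *m x) x) <= numerical_radius B * euclid_norm x ^+ 2.
Proof.
have [->|x0] := eqVneq x 0.
  rewrite inner0r (Normc.normc0 R) mulr_ge0 ?numerical_radius_ge0 //.
  exact: sqr_ge0.
have := numerical_radius_unit B (euclid_norm_normalize x0).
rewrite -scalemxAr innerZl innerZr mulrA !Normc.normcM normc_conj normc_real.
rewrite ger0_norm ?invr_ge0 ?euclid_norm_ge0 // -expr2 exprVn mulrC.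
by rewrite ler_pdivrMr // exprn_gt0 // lt_def euclid_norm_eq0 x0 euclid_norm_ge0.
Qed.

(** The sign condition on [c] takes care of dimension 0, where the set of values is empty. *)
Lemma numerical_radius_le n (B : 'M[C]_n) c : 0 <= c ->
  (forall x, euclid_norm x = 1 -> Normc.normc (inner (B *m x) x) <= c) ->
  numerical_radius B <= c.
Proof.
move=> c0 hB; rewrite /numerical_radius.
have [->|/set0P E0] := eqVneq [set Normc.normc (inner (B *m x) x)
             | x in [set x : 'cV[C]_n | euclid_norm x = 1]] set0.
  by rewrite sup0.
by apply: ge_sup => // _ [x x1 <-]; exact: hB.
Qed.

Lemma min_modulus_le p q (B : 'M[C]_(p, q)) x :
  euclid_norm x = 1 -> min_modulus B <= euclid_norm (B *m x).
Proof.
move=> x1; apply: ge_inf; last by exists x.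
by exists 0 => _ [y _ <-]; exact: euclid_norm_ge0.
Qed.

Lemma min_modulus_ge0 p q (B : 'M[C]_(p, q)) : 0 <= min_modulus B.
Proof.
rewrite /min_modulus; set E := (X in inf X).
have [->|/set0P E0] := eqVneq E set0; first by rewrite inf0.
by apply: lb_le_inf => // _ [y _ <-]; exact: euclid_norm_ge0.
Qed.

End NumericalRadius.

(** * Weighted shifts *)

Section WeightedShift.
Variable R : realType.
Local Notation C := R[i].
Import numFieldNormedType.Exports.
Local Open Scope classical_set_scope.

Lemma inner_weighted_shift k (a : nat -> R) (x : 'cV[C]_k.+1) :
  inner (weighted_shift k.+1 a *m x) x =
  \sum_(i < k) (a i)%:C%C * (x (inord i.+1) 0 * (x (inord i) 0)^*).
Proof.
(* The last row of the shift is zero, which leaves [k] terms. *)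
rewrite /inner big_ord_recr /= [X in _ + X](_ : _ = 0) => [|]; last first.
  rewrite mxE big1 ?mul0r // => j _; rewrite mxE /= ltn_eqF ?ltn_ord ?mul0r //.
rewrite addr0; apply: eq_bigr => i _.
have ii : widen_ord (leqnSn k) i = inord i.
  by apply: val_inj; rewrite /= inordK // ltnW // ltnS.
rewrite mulrA ii; congr (_ * _).
rewrite mxE (bigD1 (inord i.+1)) //= big1 => [|j ji].
  by rewrite mxE !inordK ?eqxx ?addr0 // ?ltnS // ltnW.
rewrite mxE inordK; last by rewrite ltnW // ltnS.
case: eqP => [ej|]; last by rewrite mul0r.
by case/eqP: ji; apply: val_inj; rewrite /= ej inordK // ltnS.
Qed.

Lemma continuous_sum (T : topologicalType) (I : Type) (r : seq I)
    (F : I -> T -> R) :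
  (forall i, continuous (F i)) -> continuous (fun x => \sum_(i <- r) F i x).
Proof.
move=> cF; elim: r => [|i r IHr] x.
  by under eq_fun do rewrite big_nil; exact: cvg_cst.
under eq_fun do rewrite big_cons.
by apply: cvgD; [exact: cF|exact: IHr].
Qed.

Lemma continuous_coordM n (i j : 'I_n) :
  continuous (fun v : 'rV[R]_n => v 0 i * v 0 j).
Proof.
move=> v; pose f s := fun w : 'rV[R]_n => w 0 s.
have cf s : continuous (f s) by exact: coord_continuous.
exact: (continuousM (cf i v) (cf j v)).
Qed.

(** Real vectors suffice: only the moduli of the coordinates enter the maximization below. *)
Lemma sphere_compact n :
  compact [set v : 'rV[R]_n | \sum_(i < n) v 0 i ^+ 2 = 1].
Proof.
apply: bounded_closed_compact.
  exists 1; split => // M M1 v /= v1; apply: le_trans (ltW M1).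
  rewrite [leLHS]/Num.Def.normr /= mx_normrE; apply/bigmax_leP.
  split => // -[i j] _ /=.
  rewrite -(@ler_pXn2r _ 2) ?nnegrE // expr1n real_normK ?num_real // ord1.
  rewrite -v1 (bigD1 j) //= lerDl sumr_ge0 // => s _; exact: sqr_ge0.
apply: (@preimage_closed _ _ (fun v : 'rV[R]_n => \sum_(i < n) v 0 i ^+ 2) [set 1]).
  move=> v _; apply: continuous_sum => i w; exact: continuous_coordM.
exact: closed_eq.
Qed.

(** With nonnegative weights, replacing the coordinates of [x] by their moduli can only increase the
    modulus of the quadratic form, so its maximum over the real sphere bounds the numerical
    radius. *)
Lemma weighted_shift_maximizer k (a : nat -> R) :
  (forall i, 0 <= a i) ->
  exists y : nat -> R, [/\ forall i, 0 <= y i,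
    \sum_(i < k.+1) y i ^+ 2 = 1 &
    numerical_radius (weighted_shift k.+1 a)
    <= \sum_(i < k) a i * (y i * y i.+1)].
Proof.
move=> a0.
pose f (v : 'rV[R]_k.+1) := \sum_(i < k) a i * (v 0 (inord i) * v 0 (inord i.+1)).
pose S := [set v : 'rV[R]_k.+1 | \sum_(i < k.+1) v 0 i ^+ 2 = 1].
have [|||c cS cmax] := @EVT_max_rV R k.+1 f S.
- exists (delta_mx 0 0) => /=; rewrite /S /= (bigD1 ord0) //= big1 => [|i i0].
    by rewrite mxE !eqxx expr1n addr0.
  by rewrite mxE (negPf i0) andbF expr0n.
- exact: sphere_compact.
- apply: continuous_subspaceT => v; apply: continuous_sum => i w.
  exact: (continuousM (@cst_continuous _ _ (a i) w)
    (@continuous_coordM _ (inord i) (inord i.+1) w)).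
(* Taking absolute values of the maximizer [c] does not decrease [f]. *)
exists (fun i => `|c 0 (inord i)|); split => //.
  rewrite inE /S /= in cS; rewrite -[RHS]cS; apply: eq_bigr => i _.
  by rewrite inord_val real_normK ?num_real.
have fle (v : 'rV[R]_k.+1) :
    f v <= \sum_(i < k) a i * (`|v 0 (inord i)| * `|v 0 (inord i.+1)|).
  by apply: ler_sum => i _; rewrite ler_wpM2l // -normrM ler_norm.
apply: le_trans (fle c).
have vS (x : 'cV[C]_k.+1) : euclid_norm x = 1 ->
    \row_i Normc.normc (x i 0) \in S.
  move=> x1; rewrite inE /S /=.
  transitivity (euclid_norm x ^+ 2); last by rewrite x1 expr1n.
  by rewrite euclid_norm_sqr; apply: eq_bigr => i _; rewrite mxE.
apply: numerical_radius_le => [|x x1].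
  apply: le_trans (cmax _ (vS _ (euclid_norm_delta R ord0))).
  by apply: sumr_ge0 => i _; rewrite !mxE !mulr_ge0 ?normc_ge0.
apply: le_trans (cmax _ (vS _ x1)).
rewrite inner_weighted_shift (le_trans (normc_sum _ _ _)) //.
apply: ler_sum => i _; rewrite !Normc.normcM normc_conj normc_real ger0_norm //.
by rewrite !mxE [X in _ * X]mulrC.
Qed.

End WeightedShift.

(** * Graded operators and extremal vectors *)

Section Extremal.
Variable R : realType.
Local Notation C := R[i].

Lemma ReD (x y : C) : complex.Re (x + y) = complex.Re x + complex.Re y.
Proof. by case: x y => [a b] [c d]. Qed.

Lemma Re_realM (a : R) (x : C) : complex.Re (a%:C%C * x) = a * complex.Re x.
Proof. by case: x => [c d] /=; rewrite mul0r subr0. Qed.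

Lemma Re_conj (x : C) : complex.Re (x^*) = complex.Re x.
Proof. by case: x. Qed.

(** First-order condition: [z] maximizes the real quadratic form of [M - w], whose gradient at [z]
    is [G] below. Moving from [z] along [G] would exceed the maximum unless [G = 0]. *)
Lemma numerical_range_support N (M : 'M[C]_N) (w : R) (z : 'cV[C]_N) :
  (forall x, complex.Re (inner (M *m x) x) <= w * euclid_norm x ^+ 2) ->
  complex.Re (inner (M *m z) z) = w * euclid_norm z ^+ 2 ->
  M *m z + map_mx Num.conj M^T *m z = (2 * w)%:C%C *: z.
Proof.
move=> wM wz; set Mz := M *m z; set M'z := _ *m z.
pose G := Mz + M'z + (- (2 * w))%:C%C *: z.
suff : G = 0.
  by move/eqP; rewrite addr_eq0 rmorphN /= scaleNr opprK => /eqP.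
pose r (x y : 'cV[C]_N) := complex.Re (inner x y).
have rDl x1 x2 y : r (x1 + x2) y = r x1 y + r x2 y by rewrite /r innerDl ReD.
have rDr x1 x2 y : r y (x1 + x2) = r y x1 + r y x2 by rewrite /r innerDr ReD.
have rZl a x y : r (a%:C%C *: x) y = a * r x y by rewrite /r innerZl Re_realM.
have rC x y : r x y = r y x by rewrite /r innerC Re_conj.
have rZr a x y : r y (a%:C%C *: x) = a * r y x by rewrite rC rZl rC.
have rr x : r x x = euclid_norm x ^+ 2 by rewrite /r inner_sqnorm.
(* The coefficient of [t] in the form at [z + t G], rewritten with [Mz + M'z = 2 w z + G]. *)
have rG : r Mz G + r (M *m G) z = 2 * w * r z G + r G G.
  rewrite [r (M *m G) z]/r inner_adj -/(r G M'z) (rC _ M'z) -rDl.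
  by rewrite [in r G G]/G [in RHS]rDl rZl; ring.
clearbody G.
pose q := w * r G G - r (M *m G) G.
have q0 : 0 <= q by rewrite subr_ge0 rr wM.
have hq t : 0 <= - t * r G G + t ^+ 2 * q.
  have e1 : r (M *m (z + t%:C%C *: G)) (z + t%:C%C *: G) =
      r Mz z + t * (r Mz G + r (M *m G) z) + t ^+ 2 * r (M *m G) G.
    rewrite mulmxDr -scalemxAr -/Mz rDl !rDr !rZl !rZr; ring.
  have e2 : r (z + t%:C%C *: G) (z + t%:C%C *: G) =
      r z z + 2 * t * r z G + t ^+ 2 * r G G.
    rewrite rDl !rDr !rZl !rZr (rC G z); ring.
  have h : r (M *m (z + t%:C%C *: G)) (z + t%:C%C *: G) <=
      w * r (z + t%:C%C *: G) (z + t%:C%C *: G) by rewrite rr; exact: wM.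
  have wz' : r Mz z = w * r z z by rewrite rr.
  move: h; rewrite e1 e2 wz' rG /q => h.
  by lra.
apply/eqP; rewrite -inner_eq0 inner_sqnorm -rr.
have g0 : 0 <= r G G by rewrite rr sqr_ge0.
(* This value of [t] makes the right side of [hq] equal to [- t ^+ 2]; the [+ 1] allows for
   [q = 0]. *)
have := hq (r G G / (q + 1)).
have q1 : 0 < q + 1 by lra.
rewrite (_ : _ + _ = - (r G G / (q + 1)) ^+ 2); last by field; lra.
rewrite oppr_ge0 => h.
have : r G G / (q + 1) == 0 by rewrite -sqrf_eq0 eq_le h sqr_ge0.
by rewrite mulf_eq0 invr_eq0 (gt_eqF q1) orbF => /eqP ->.
Qed.

End Extremal.

Section Graded.
Variable R : realType.
Local Notation C := R[i].
Variables (N : nat) (lev : 'I_N -> nat) (M : 'M[C]_N).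
Hypothesis levM : forall s t, M s t != 0 -> lev t = (lev s).+1.

(** Membership in the summand of degree [i], as a condition on supports, so that all vectors keep
    one type. The zero vector has every degree. *)
Definition homog i (x : 'cV[C]_N) := forall s, x s 0 != 0 -> lev s = i.

Lemma homogZ i a x : homog i x -> homog i (a *: x).
Proof. by move=> hx s; rewrite mxE mulf_eq0 => /norP[_ /hx]. Qed.

Lemma homog_mul i x : homog i.+1 x -> homog i (M *m x).
Proof.
move=> hx s; rewrite mxE; apply: contraNeq => /eqP si.
rewrite big1 // => t _; have [->|/levM Mt] := eqVneq (M s t) 0.
  by rewrite mul0r.
have [->|/hx xt] := eqVneq (x t 0) 0; first by rewrite mulr0.
by case: si; move: xt; rewrite Mt => -[].
Qed.

Lemma homog0_mul x : homog 0 x -> M *m x = 0.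
Proof.
move=> hx; apply/colP => s; rewrite !mxE big1 // => t _.
have [->|/levM Mt] := eqVneq (M s t) 0; first by rewrite mul0r.
have [->|/hx xt] := eqVneq (x t 0) 0; first by rewrite mulr0.
by move: xt; rewrite Mt.
Qed.

Lemma inner_homog i j x y : homog i x -> homog j y -> i <> j -> inner x y = 0.
Proof.
move=> hx hy ij; rewrite /inner big1 // => s _.
have [->|/hx xs] := eqVneq (x s 0) 0; first by rewrite mul0r.
have [->|/hy ys] := eqVneq (y s 0) 0; first by rewrite conjC0 mulr0.
by case: ij; rewrite -xs -ys.
Qed.

(* When [M *m u i.+1] vanishes, the descent restarts from [u i = e i]. *)
Lemma homog_descent k (e : nat -> 'cV[C]_N) :
  (forall i, (i <= k)%N -> homog i (e i) /\ euclid_norm (e i) = 1) ->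
  exists u : nat -> 'cV[C]_N,
  [/\ u k = e k, forall i, (i <= k)%N -> homog i (u i),
      forall i, (i <= k)%N -> euclid_norm (u i) = 1 &
      forall i, (i < k)%N ->
        M *m u i.+1 = (euclid_norm (M *m u i.+1))%:C%C *: u i].
Proof.
move=> he.
pose next i (x : 'cV[C]_N) := if M *m x == 0 then e i
  else (euclid_norm (M *m x))^-1%:C%C *: (M *m x).
(* [v r] lives in degree [k - r]: the recursion starts at the last summand. *)
pose v := fix v r := if r is r'.+1 then next (k - r)%N (v r') else e k.
have hv r : (r <= k)%N -> homog (k - r) (v r) /\ euclid_norm (v r) = 1.
  elim: r => [_|r IHr rk]; first by rewrite subn0; exact: he.
  have [hr _] := IHr (ltnW rk); rewrite /= /next.
  case: eqP => [_|/eqP Mv0]; first by apply: he; rewrite leq_subr.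
  split; last exact: euclid_norm_normalize.
  by apply/homogZ/homog_mul; rewrite subnSK.
exists (fun i => v (k - i)%N); split=> [|i ik|i ik|i ik].
- by rewrite subnn.
- by have [] := hv _ (leq_subr i k); rewrite subKn.
- by have [] := hv _ (leq_subr i k).
rewrite -(subnSK ik) /= /next; set x := v _.
case: eqP => [->|/eqP]; first by rewrite euclid_norm0 scale0r.
rewrite -euclid_norm_eq0 => x0.
by rewrite scalerA -rmorphM /= divff // scale1r.
Qed.

Variables (k : nat) (u : nat -> 'cV[C]_N) (b y : nat -> R).
Hypothesis homog_u : forall i, (i <= k)%N -> homog i (u i).
Hypothesis unit_u : forall i, (i <= k)%N -> euclid_norm (u i) = 1.
Hypothesis Mu : forall i, (i < k)%N -> M *m u i.+1 = (b i)%:C%C *: u i.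

Let z := \sum_(i < k.+1) (y i)%:C%C *: u i.

Lemma inner_u_homog i j v : (i <= k)%N -> homog j v -> i <> j ->
  inner (u i) v = 0.
Proof. by move=> ik hv; apply: inner_homog hv; exact: homog_u. Qed.

(** Different degrees are orthogonal, so pairing with a homogeneous vector reads an equation about
    [z] on a single summand. *)
Lemma inner_comb j v : (j <= k)%N -> homog j v ->
  inner z v = (y j)%:C%C * inner (u j) v.
Proof.
move=> jk hv; rewrite inner_suml (bigD1 (Ordinal (jk : (j < k.+1)%N))) //=.
rewrite big1 ?addr0 ?innerZl // => i ij; rewrite innerZl.
have ik : (i <= k)%N by rewrite -ltnS.
by rewrite (inner_u_homog ik hv) ?mulr0 // => e; case/eqP: ij; exact: val_inj.
Qed.

Lemma inner_uu j : (j <= k)%N -> inner (u j) (u j) = 1.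
Proof. by move=> jk; apply/euclid_norm_unit/unit_u. Qed.

Lemma inner_combu j : (j <= k)%N -> inner z (u j) = (y j)%:C%C.
Proof.
by move=> jk; rewrite (inner_comb jk) ?inner_uu ?mulr1 //; exact: homog_u.
Qed.

Lemma sqnorm_comb : euclid_norm z ^+ 2 = \sum_(i < k.+1) y i ^+ 2.
Proof.
apply: complexI; rewrite -inner_sqnorm {2}/z inner_sumr rmorph_sum.
apply: eq_bigr => i _; have ik : (i <= k)%N by rewrite -ltnS.
rewrite innerZr (inner_combu ik) conjC_real; exact/esym/rmorphM.
Qed.

Lemma mul_comb : M *m z = \sum_(i < k) (y i.+1 * b i)%:C%C *: u i.
Proof.
rewrite /z big_ord_recl mulmxDr -scalemxAr (homog0_mul (homog_u (leq0n k))).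
rewrite scaler0 add0r mulmx_sumr; apply: eq_bigr => i _.
rewrite -scalemxAr (Mu (ltn_ord i)) scalerA; congr (_ *: _); exact/esym/rmorphM.
Qed.

Lemma inner_mul_comb :
  inner (M *m z) z = (\sum_(i < k) b i * (y i * y i.+1))%:C%C.
Proof.
rewrite mul_comb inner_suml rmorph_sum; apply: eq_bigr => i _.
rewrite innerZl innerC (inner_combu (ltnW (ltn_ord i))) conjC_real -rmorphM /=.
by congr (_%:C%C); ring.
Qed.

Lemma inner_mul_combv j v : (j <= k)%N -> homog j v ->
  inner (M *m z) v = if (j < k)%N then (y j.+1 * b j)%:C%C * inner (u j) v else 0.
Proof.
move=> jk hv; rewrite mul_comb inner_suml; case: ltnP => [ltjk|kj].
  rewrite (bigD1 (Ordinal ltjk)) //= big1 ?addr0 ?innerZl // => i ij.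
  rewrite innerZl (inner_u_homog (ltnW (ltn_ord i)) hv) ?mulr0 // => e.
  by case/eqP: ij; exact: val_inj.
rewrite big1 // => i _; rewrite innerZl.
rewrite (inner_u_homog (ltnW (ltn_ord i)) hv) ?mulr0 // => e.
by have := leq_trans (ltn_ord i) kj; rewrite e ltnn.
Qed.

Lemma le_numerical_radius_comb :
  \sum_(i < k.+1) y i ^+ 2 = 1 ->
  \sum_(i < k) b i * (y i * y i.+1) <= numerical_radius M.
Proof.
rewrite -sqnorm_comb => z1.
have := numerical_radius_ub M z; rewrite z1 mulr1; apply: le_trans.
by rewrite inner_mul_comb normc_real ler_norm.
Qed.

Hypothesis y_ge0 : forall i, 0 <= y i.
Hypothesis y_unit : \sum_(i < k.+1) y i ^+ 2 = 1.
Hypothesis b_gt0 : forall i, (i < k)%N -> 0 < b i.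
Hypothesis extremal :
  \sum_(i < k) b i * (y i * y i.+1) = numerical_radius M.

(** By extremality [M z + M^* z = 2 w z]. Pairing with [v], and moving [M^*] onto [v] as [M], leaves
    only the contributions of the degrees next to [j]; the conditionals are the two ends of the
    chain. *)
Lemma comb_eigen j v : (j <= k)%N -> homog j v ->
  (if (j < k)%N then (y j.+1 * b j)%:C%C * inner (u j) v else 0) +
  (if j is j'.+1 then (y j')%:C%C * inner (u j') (M *m v) else 0)
  = (2 * numerical_radius M * y j)%:C%C * inner (u j) v.
Proof.
move=> jk hv.
have : inner (M *m z + map_mx Num.conj M^T *m z) v =
       inner ((2 * numerical_radius M)%:C%C *: z) v.
  congr (inner _ v); apply: numerical_range_support => [x|].
    exact: le_trans (Re_le_normc _) (numerical_radius_ub M x).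
  by rewrite inner_mul_comb sqnorm_comb y_unit mulr1 extremal.
rewrite innerDl (inner_mul_combv jk hv) innerZl (inner_comb jk hv) mulrA.
rewrite -rmorphM => <-; congr (_ + _).
rewrite innerC -inner_adj -innerC.
case: j jk hv => [|j] jk hv; first by rewrite homog0_mul ?inner0r.
by apply/esym/inner_comb; [exact: ltnW|exact: homog_mul].
Qed.

(** The case [v = u j]: [y] is an eigenvector of the real part of the weighted shift with weights
    [b]. *)
Lemma comb_recurrence j : (j <= k)%N ->
  (if (j < k)%N then y j.+1 * b j else 0) +
  (if j is j'.+1 then y j' * b j' else 0) = 2 * numerical_radius M * y j.
Proof.
move=> jk; apply: complexI.
have := comb_eigen jk (homog_u jk); rewrite (inner_uu jk) !mulr1 => <-.
rewrite rmorphD /=; congr (_ + _); first by case: ltnP.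
case: j jk => [|j] jk //.
rewrite (Mu jk) innerZr conjC_real (inner_uu (ltnW jk)) mulr1; exact: rmorphM.
Qed.

(** As for Perron vectors: where [y] vanishes, the recurrence says that a sum of nonnegative terms
    is zero, so [y] vanishes at the neighbours too, hence everywhere, against its norm being 1. *)
Lemma comb_pos j : (j <= k)%N -> 0 < y j.
Proof.
move=> jk; rewrite lt_def y_ge0 andbT; apply/eqP => yj0.
have step i : (i <= k)%N -> y i = 0 ->
    (if (i < k)%N then y i.+1 * b i else 0) = 0 /\
    (if i is i'.+1 then y i' * b i' else 0) = 0.
  move=> ik yi; have := comb_recurrence ik; rewrite yi mulr0 => /eqP.
  rewrite paddr_eq0 => [/andP[/eqP-> /eqP->] //||].
    by case: ltnP => // ltik; rewrite mulr_ge0 // ltW // b_gt0.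
  by case: i ik {yi} => // i ik; rewrite mulr_ge0 // ltW // b_gt0.
(* The zero travels down to index 0, then up through all indices. *)
have y00 : y 0%N = 0.
  elim: j jk yj0 => // j IHj jk yj; apply: IHj; first exact: ltnW.
  have [_ /eqP] := step _ jk yj.
  by rewrite mulf_eq0 (gt_eqF (b_gt0 jk)) orbF => /eqP.
have yk0 i : (i <= k)%N -> y i = 0.
  elim: i => // i IHi ik; have [+ _] := step _ (ltnW ik) (IHi (ltnW ik)).
  rewrite ik => /eqP.
  by rewrite mulf_eq0 (gt_eqF (b_gt0 ik)) orbF => /eqP.
move/eqP: y_unit; rewrite big1 => [|i _]; first by rewrite eq_sym oner_eq0.
by rewrite yk0 ?expr0n // -ltnS.
Qed.

(** In [comb_eigen] everything but [y i] times the pairing of [u i] with [M *m v] vanishes, and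
    [y i] is positive. *)
Lemma comb_orthogonal i v : (i < k)%N -> homog i.+1 v ->
  inner (u i.+1) v = 0 -> inner (M *m v) (u i) = 0.
Proof.
move=> ik hv uv; have := comb_eigen ik hv; rewrite uv !mulr0.
rewrite (_ : (if _ then _ else _) = 0) ?add0r; last by case: ifP.
move/eqP; rewrite mulf_eq0 -(rmorph0 (real_complex R)) (inj_eq (@complexI R)).
rewrite (gt_eqF (comb_pos (ltnW ik))) => /eqP h.
by rewrite innerC h conjC0.
Qed.

(** The two sums are ordered term by term and their totals are equal, so each term agrees; the
    positive factors [y i * y i.+1] cancel. *)
Lemma comb_weights (a : nat -> R) : (forall i, (i < k)%N -> a i <= b i) ->
  numerical_radius M <= \sum_(i < k) a i * (y i * y i.+1) ->
  forall i, (i < k)%N -> b i = a i.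
Proof.
move=> ab; rewrite -extremal -subr_le0 -sumrB => h i ik.
have F0 (j : 'I_k) : true ->
    0 <= b j * (y j * y j.+1) - a j * (y j * y j.+1).
  by move=> _; rewrite -mulrBl !mulr_ge0 // subr_ge0 ab.
have S0 : \sum_(j < k) (b j * (y j * y j.+1) - a j * (y j * y j.+1)) = 0.
  by apply: le_anti; rewrite h sumr_ge0.
have /= /eqP := psumr_eq0P F0 S0 (i := Ordinal ik) isT.
rewrite -mulrBl !mulf_eq0 (gt_eqF (comb_pos (ltnW ik))).
by rewrite (gt_eqF (comb_pos ik)) !orbF subr_eq0 => /eqP.
Qed.

End Graded.

(** * Graded orthonormal bases and unitary similarity *)

Section GradedBasis.
Variable R : realType.
Local Notation C := R[i].

Lemma homog_delta N (lev : 'I_N -> nat) s :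
  homog (R := R) lev (lev s) (delta_mx s 0).
Proof.
move=> t; rewrite mxE eqxx andbT.
by case: (eqVneq t s) => [-> |]; rewrite ?eqxx.
Qed.

(** Up to sign, the amount by which the Gram matrix of the reflected basis below differs from the
    identity. The convention [0^-1 = 0] includes the degenerate case [d = 0]. *)
Lemma householder_coef (d p q : C) :
  p * q^* * (d^-1 + (d^-1)^* - d^-1 * (d^-1)^* * (d + d^*)) = 0.
Proof.
have [->|d0] := eqVneq d 0.
  by rewrite invr0 conjC0 !(mul0r, addr0, subrr, mulr0).
have D0 : d^* != 0 by rewrite conjC_eq0.
have -> : (d^-1)^* = (d^*)^-1 by exact: fmorphV.
move: (d^*) (q^*) D0 => D Q D0.
by field; apply/andP.
Qed.

(* The complex reflection [1 - v v^* / <e, v>] with [v = e - u] is unitary and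
   maps the basis vector [e] to [u], without any choice of phase. *)
Lemma homog_reflection N (lev : 'I_N -> nat) (u : 'cV[C]_N) s0 :
  homog lev (lev s0) u -> euclid_norm u = 1 ->
  exists h : 'I_N -> 'cV[C]_N,
  [/\ forall s t, inner (h s) (h t) = (s == t)%:R, h s0 = u &
      forall s, homog lev (lev s) (h s)].
Proof.
move=> hu /euclid_norm_unit uu.
pose de s : 'cV[C]_N := delta_mx s 0.
have deE s t : inner (de s) (de t) = (s == t)%:R.
  by rewrite inner_deltar mxE eqxx andbT eq_sym.
pose v := de s0 + (- 1) *: u; pose d := inner (de s0) v.
have N1 : (- 1 : C)^* = - 1 by rewrite rmorphN1.
have dE : d = 1 - inner (de s0) u.
  by rewrite /d innerDr deE eqxx innerZr N1 mulN1r.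
(* Uses that the basis vector and [u] are both unit; this identity is what makes the reflection
   unitary. *)
have vv : inner v v = d + d^*.
  rewrite {1}/v innerDl innerZl -/d mulN1r; congr (_ + _).
  by rewrite dE rmorphB /= conjC1 -innerC innerDr innerZr N1 uu; ring.
have hv : homog lev (lev s0) v.
  move=> s; rewrite !mxE mulN1r; have [->|us _] := eqVneq (u s 0) 0; last exact: hu.
  by rewrite subr0 eqxx andbT; case: (eqVneq s s0) => [-> |]; rewrite ?eqxx.
pose c s := - (d^-1 * inner (de s) v).
exists (fun s => de s + c s *: v); split=> [s t||s].
- rewrite innerDl !innerDr !innerZl !innerZr deE vv (innerC v (de t)) /c.
  move: (inner (de s) v) (inner (de t) v) => p q.
  have := householder_coef d p q; rewrite rmorphN rmorphM /=.
  move: (d^*) (d^-1) ((d^-1)^*) (q^*) => D E F Q h.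
  by rewrite -[RHS]addr0 -[X in _ = _ + X]oppr0 -h; ring.
(* If [d = 0] then [v = 0]: [u] is already the basis vector and the reflection is the identity. *)
- rewrite /c -/d; have [d0|d0] := eqVneq d 0.
    have /eqP : inner v v = 0 by rewrite vv d0 conjC0 addr0.
    rewrite inner_eq0 => /eqP v0; rewrite v0 scaler0 addr0; move: v0; rewrite /v.
    by rewrite scaleN1r => /eqP; rewrite subr_eq0 => /eqP.
  by rewrite mulVf // scaleN1r /v scaleN1r opprB addrC subrK.
(* Within the level of [s0] vectors move along [v], which lies in that level; the other basis
   vectors are orthogonal to [v], hence fixed. *)
- have [ls|ls] := eqVneq (lev s) (lev s0).
    move=> t ht.
    have [vt|] := eqVneq (v t 0) 0; last by rewrite ls; exact: hv.
    by apply: homog_delta; move: ht; rewrite mxE [X in _ + X]mxE vt mulr0 addr0.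
  rewrite /c (inner_homog (@homog_delta _ lev s) hv); last by move/eqP: ls.
  by rewrite mulr0 oppr0 scale0r addr0; exact: homog_delta.
Qed.

(** One reflection is chosen per level, and each index uses that of its own level; orthogonality
    across levels is automatic. *)
Lemma homog_orthonormal_basis N k (lev : 'I_N -> 'I_k) (top : 'I_k -> 'I_N)
    (u : nat -> 'cV[C]_N) :
  (forall i, lev (top i) = i) ->
  (forall i : 'I_k, homog (fun s => lev s) i (u i)) ->
  (forall i : 'I_k, euclid_norm (u i) = 1) ->
  exists f : 'I_N -> 'cV[C]_N,
  [/\ forall s t, inner (f s) (f t) = (s == t)%:R,
      forall i : 'I_k, f (top i) = u i &
      forall s, homog (fun s => lev s) (lev s) (f s)].
Proof.
move=> ltop hu u1.
have /choice[h hh] (i : 'I_k) : exists h : 'I_N -> 'cV[C]_N,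
    [/\ forall s t, inner (h s) (h t) = (s == t)%:R, h (top i) = u i &
        forall s, homog (fun s => lev s) (lev s) (h s)].
  apply: (@homog_reflection _ (fun s => lev s)) (u1 i).
  by rewrite ltop; exact: hu.
exists (fun s => h (lev s) s); split=> [s t|i|s].
- have [lst|lst] := eqVneq (lev s) (lev t).
    by rewrite lst; have [-> _ _] := hh (lev t).
  have [_ _ hs] := hh (lev s); have [_ _ ht] := hh (lev t).
  rewrite (inner_homog (hs s) (ht t)); last by move/val_inj/eqP; rewrite (negPf lst).
  by case: (eqVneq s t) lst => [-> |]; rewrite ?eqxx.
- by rewrite ltop; have [_ -> _] := hh i.
- by have [_ _ hs] := hh (lev s); exact: hs.
Qed.

End GradedBasis.

Section Similarity.
Variable R : realType.
Local Notation C := R[i].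

(** [N] is the matrix of [M] in the orthonormal basis [f]; the unitary has the adjoints of the [f s]
    as its rows. *)
Lemma unitarily_similar_orthonormal p q (M : 'M[C]_p) (N : 'M[C]_q)
    (f : 'I_q -> 'cV[C]_p) :
  p = q -> (forall s t, inner (f s) (f t) = (s == t)%:R) ->
  (forall s t, N s t = inner (M *m f t) (f s)) ->
  unitarily_similar M N.
Proof.
move=> e fE NE; exists e; case: q / e in N f fE NE *.
pose U : 'M[C]_p := \matrix_(s, t) (f s t 0)^*.
have Ut : map_mx Num.conj U^T = \matrix_(t, s) f s t 0.
  by apply/matrixP => s t; rewrite !mxE; exact: conjCK.
have UU : U \is unitarymx.
  apply/unitarymxP/matrixP => s t; rewrite Ut !mxE eq_sym -fE.
  by apply: eq_bigr => i _; rewrite !mxE mulrC.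
exists U; split => //; rewrite castmx_id.
have UtU : map_mx Num.conj U^T *m U = 1%:M by exact/mulmx1C/unitarymxP.
have -> : N = U *m M *m map_mx Num.conj U^T.
  apply/matrixP => s t; rewrite NE Ut -mulmxA [RHS]mxE.
  apply: eq_bigr => i _; rewrite [U s i]mxE mulrC; congr (_ * _).
  by rewrite !mxE; apply: eq_bigr => j _; rewrite !mxE.
by rewrite !mulmxA UtU mul1mx -mulmxA UtU mulmx1.
Qed.

Lemma inner_unitary n (U : 'M[C]_n) x y : U \is unitarymx ->
  inner (U *m x) (U *m y) = inner x y.
Proof.
move=> UU; have UtU : map_mx Num.conj U^T *m U = 1%:M by exact/mulmx1C/unitarymxP.
by rewrite inner_adj mulmxA UtU mul1mx.
Qed.

(** Invariance of the quadratic form, in a shape that hides the unitary and the transport between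
    dimensions. *)
Lemma unitarily_similar_inner p q (M : 'M[C]_p) (N : 'M[C]_q) :
  unitarily_similar M N ->
  (forall x, exists y, inner (M *m x) x = inner (N *m y) y /\
                       euclid_norm x = euclid_norm y) /\
  (forall y, exists x, inner (M *m x) x = inner (N *m y) y /\
                       euclid_norm x = euclid_norm y).
Proof.
case=> e [U [UU]]; case: q / e in N U UU *; rewrite castmx_id => ->.
have normU x : euclid_norm (U *m x) = euclid_norm x.
  apply/eqP; rewrite -(@eqrXn2 _ 2) ?euclid_norm_ge0 //.
  apply/eqP; apply: complexI; rewrite -!inner_sqnorm; exact: inner_unitary.
have h x : inner (map_mx Num.conj U^T *m N *m U *m x) x =
           inner (N *m (U *m x)) (U *m x).
  have UK : map_mx Num.conj (map_mx Num.conj U^T)^T = U.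
    by apply/matrixP => i j; rewrite !mxE; exact: conjCK.
  by rewrite -!mulmxA (inner_adj (map_mx Num.conj U^T)) UK.
split=> [x|y]; first by exists (U *m x); rewrite normU h.
exists (map_mx Num.conj U^T *m y).
have E : U *m (map_mx Num.conj U^T *m y) = y.
  by rewrite mulmxA (unitarymxP UU) mul1mx.
by rewrite h E -normU E.
Qed.

Lemma inner_dsum p q (M : 'M[C]_p) (N : 'M[C]_q) x1 x2 :
  inner (dsum_mx M N *m col_mx x1 x2) (col_mx x1 x2) =
  inner (M *m x1) x1 + inner (N *m x2) x2.
Proof.
rewrite mul_block_col !mul0mx addr0 add0r /inner big_split_ord.
by congr (_ + _); apply: eq_bigr => i _; rewrite ?col_mxEu ?col_mxEd.
Qed.

Lemma euclid_norm_col_mx p q (x1 : 'cV[C]_p) (x2 : 'cV[C]_q) :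
  euclid_norm (col_mx x1 x2) ^+ 2 = euclid_norm x1 ^+ 2 + euclid_norm x2 ^+ 2.
Proof.
rewrite !euclid_norm_sqr big_split_ord.
by congr (_ + _); apply: eq_bigr => i _; rewrite ?col_mxEu ?col_mxEd.
Qed.

Lemma numerical_radius_summand p q r (M : 'M[C]_p) (N : 'M[C]_q) (Q : 'M[C]_r) :
  unitarily_similar M (dsum_mx N Q) -> numerical_radius Q <= numerical_radius M.
Proof.
move=> /unitarily_similar_inner[_ sim].
apply: numerical_radius_le => [|x x1]; first exact: numerical_radius_ge0.
have [z []] := sim (col_mx 0 x); rewrite inner_dsum inner0r add0r => <- z1.
apply: numerical_radius_unit; rewrite z1; apply/eqP.
rewrite -(@eqrXn2 _ 2) ?euclid_norm_ge0 // euclid_norm_col_mx x1 expr1n.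
by rewrite euclid_norm0 expr0n add0r.
Qed.

(** The bound on [Q] is homogeneous because the components of a unit vector need not be unit; their
    squared norms add up to 1. *)
Lemma numerical_radius_dsum p q r (M : 'M[C]_p) (N : 'M[C]_q) (Q : 'M[C]_r) :
  unitarily_similar M (dsum_mx N Q) ->
  (forall x, Normc.normc (inner (Q *m x) x)
             <= numerical_radius N * euclid_norm x ^+ 2) ->
  numerical_radius M <= numerical_radius N.
Proof.
move=> /unitarily_similar_inner[sim _] hQ.
apply: numerical_radius_le => [|x x1]; first exact: numerical_radius_ge0.
have [z [-> zx]] := sim x; rewrite -[z]vsubmxK inner_dsum.
apply: le_trans (le_normcD _ _) _.
apply: le_trans (lerD (numerical_radius_ub N _) (hQ _)) _.
by rewrite -mulrDr -euclid_norm_col_mx vsubmxK -zx x1 expr1n mulr1.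
Qed.

End Similarity.

(** * Block shifts *)

(** Positions are compared in [nat] because their types depend on the block number. *)
Lemma tagnat_ext n (p_ : 'I_n -> nat) (s t : 'I_(\sum_i p_ i)) :
  sig1 s = sig1 t -> sig2 s = sig2 t :> nat -> s = t.
Proof.
move=> e1 e2; rewrite -[s]sig2K -[t]sig2K; apply: val_inj; apply/eqP.
rewrite eq_Rank; apply/andP; split; exact/eqP.
Qed.

Lemma big_tagnat (R : nmodType) n (p_ : 'I_n -> nat)
    (F : 'I_(\sum_i p_ i) -> R) :
  \sum_s F s = \sum_i \sum_(j < p_ i) F (Rank i j).
Proof.
rewrite (reindex (@rank n p_)) /=; last exact: rank_bij_on.
rewrite (sig_big_dep _ (fun _ => xpredT) (fun i j => F (Rank i j))).
by apply: eq_bigr => -[i j].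
Qed.

Section BlockShift.
Variable R : realType.
Local Notation C := R[i].

Lemma block_shift_lev l n_ (B : forall j, 'M[C]_(n_ j, n_ j.+1)) s t :
  block_shift l B s t != 0 -> sig1 t = (sig1 s).+1 :> nat.
Proof.
have [//|ne] := eqVneq (sig1 t : nat) (sig1 s).+1.
by rewrite mxE (negPf ne) mxE eqxx.
Qed.

Lemma block_shift_Rank l n_ (B : forall j, 'M[C]_(n_ j, n_ j.+1)) i
    (hi : (i < l)%N) (hi1 : (i.+1 < l)%N) s t :
  block_shift l B (Rank (Ordinal hi) s) (Rank (Ordinal hi1) t) = B i s t.
Proof.
rewrite /block_shift; set B' := (X in mxblock X).
have := congr1 (fun X : 'M_(_, _) => X s t)
  (mxblockK B' (Ordinal hi) (Ordinal hi1)).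
by rewrite mxE => ->; rewrite /B' /= eqxx conform_mx_id.
Qed.

(** Entries given by a function of natural numbers make the transport in [conform_mx] disappear; the
    summand C is built in this form. *)
Lemma block_shift_matrixE l m_ (E : nat -> nat -> nat -> C) r1 r2 :
  block_shift l (fun j => \matrix_(s < m_ j, t < m_ j.+1) E j s t) r1 r2 =
  if sig1 r2 == (sig1 r1).+1 :> nat then E (sig1 r1) (sig2 r1) (sig2 r2) else 0.
Proof.
rewrite mxE; move: (sig1 r1) (sig1 r2) (sig2 r1) (sig2 r2).
move=> i [j hj] s t /=; case: eqP => [e|_]; last by rewrite mxE.
by move: t; rewrite /= e => t; rewrite conform_mx_id mxE.
Qed.

Variables (l : nat) (n_ : nat -> nat) (A_ : forall j, 'M[C]_(n_ j, n_ j.+1)).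
Let A := block_shift l A_.

Definition block i (hi : (i < l)%N) (x : 'cV[C]_(\sum_(i < l) n_ i)) :
  'cV[C]_(n_ i) := \col_t x (Rank (Ordinal hi) t) 0.

Lemma blockZ i (hi : (i < l)%N) a x : block hi (a *: x) = a *: block hi x.
Proof. by apply/colP => t; rewrite !mxE. Qed.

Lemma euclid_norm_block i (hi : (i < l)%N) x :
  homog (fun s => sig1 s) i x -> euclid_norm (block hi x) = euclid_norm x.
Proof.
move=> hx; congr Num.sqrt; rewrite big_tagnat (bigD1 (Ordinal hi)) //=.
rewrite [X in _ = _ + X]big1 ?addr0 => [|j ij].
  by apply: eq_bigr => t _; rewrite mxE.
rewrite big1 // => t _; have [->|/hx] := eqVneq (x (Rank j t) 0) 0.
  by rewrite (Normc.normc0 R) expr0n.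
by rewrite Rank1K => e; case/eqP: ij; exact: val_inj.
Qed.

Lemma block_mul i (hi : (i < l)%N) (hi1 : (i.+1 < l)%N) x :
  homog (fun s => sig1 s) i.+1 x -> block hi (A *m x) = A_ i *m block hi1 x.
Proof.
move=> hx; apply/colP => s; rewrite !mxE big_tagnat (bigD1 (Ordinal hi1)) //=.
rewrite [X in _ + X = _]big1 ?addr0 => [|j ij].
  by apply: eq_bigr => t _; rewrite [block hi1 x t 0]mxE block_shift_Rank.
rewrite big1 // => t _; have [->|/hx] := eqVneq (x (Rank j t) 0) 0.
  by rewrite mulr0.
by rewrite Rank1K => e; case/eqP: ij; exact: val_inj.
Qed.

(** A homogeneous vector has the norm of its only block, on which [A] acts as [A_ i]. *)
Lemma min_modulus_block_shift i x : (i.+1 < l)%N ->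
  homog (fun s => sig1 s) i.+1 x -> euclid_norm x = 1 ->
  min_modulus (A_ i) <= euclid_norm (A *m x).
Proof.
move=> hi1 hx x1; have hi := ltnW hi1.
rewrite -(@euclid_norm_block i hi); last first.
  by apply: homog_mul hx; exact: block_shift_lev.
rewrite (block_mul hi hi1 hx); apply: min_modulus_le.
by rewrite euclid_norm_block.
Qed.

(** Trades the last factor of the product for one application of [A], to follow nonvanishing along
    the descent. *)
Lemma chain_prod_mul_block i (hi : (i < l)%N) (hi1 : (i.+1 < l)%N) x :
  homog (fun s => sig1 s) i.+1 x ->
  chain_prod A_ i.+1 *m block hi1 x = chain_prod A_ i *m block hi (A *m x).
Proof. by move=> hx; rewrite (block_mul hi hi1 hx) /= mulmxA. Qed.

End BlockShift.

(** * Splitting the weighted shift off a block shift *)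

Section Decomposition.
Variable R : realType.
Local Notation C := R[i].
Variables (k : nat) (n_ : nat -> nat) (A_ : forall j, 'M[C]_(n_ j, n_ j.+1)).
Hypothesis n_gt0 : forall i, (i < k.+1)%N -> (1 <= n_ i)%N.
Let A := block_shift k.+1 A_.
Let lev (s : 'I_(\sum_(i < k.+1) n_ i)) : 'I_k.+1 := sig1 s.
Let A'' := weighted_shift k.+1 (fun j => min_modulus (A_ j)).

Let levA s t : A s t != 0 -> lev t = (lev s).+1 :> nat.
Proof. exact: block_shift_lev. Qed.

(** The first index of each level, reserved for [u i] in the adapted basis. *)
Let top (i : 'I_k.+1) : 'I_(\sum_(i < k.+1) n_ i) :=
  Rank i (Ordinal (n_gt0 (ltn_ord i))).

Let lev_top i : lev (top i) = i.
Proof. exact: Rank1K. Qed.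

Let pos_top i : sig2 (top i) = 0%N :> nat.
Proof. by rewrite Rank2K. Qed.

(** The starting basis vector is left free: any one serves for (a), while (b) takes one that the
    product of the blocks does not kill. *)
Lemma block_shift_descent t : lev t = k :> nat ->
  exists u : nat -> 'cV[C]_(\sum_(i < k.+1) n_ i),
  [/\ u k = delta_mx t 0,
      forall i, (i <= k)%N -> homog (fun s => lev s) i (u i),
      forall i, (i <= k)%N -> euclid_norm (u i) = 1,
      forall i, (i < k)%N -> A *m u i.+1 =
        (euclid_norm (A *m u i.+1))%:C%C *: u i &
      forall i, (i < k)%N -> min_modulus (A_ i) <= euclid_norm (A *m u i.+1)].
Proof.
move=> ltk.
pose e i : 'cV[C]_(\sum_(i < k.+1) n_ i) :=
  delta_mx (if i == k then t else top (inord i)) 0.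
have [|u [uk hu u1 Mu]] := @homog_descent R _ (fun s => lev s) _ levA k e.
  move=> i ik; split; last exact: euclid_norm_delta.
  have := @homog_delta R _ (fun s => lev s : nat)
    (if i == k then t else top (inord i)).
  by rewrite /e; case: (eqVneq i k) => [-> |_]; rewrite ?ltk // lev_top inordK.
exists u; split => //; first by rewrite uk /e eqxx.
by move=> i ik; apply: min_modulus_block_shift; [|exact: hu|exact: u1].
Qed.

Lemma weighted_shift_le_block_shift :
  numerical_radius A'' <= numerical_radius A.
Proof.
have [|y [y0 y1]] := @weighted_shift_maximizer R k (fun j => min_modulus (A_ j)).
  by move=> i; exact: min_modulus_ge0.
move=> h; apply: le_trans h _.
have [|u [_ hu u1 Mu ab]] := @block_shift_descent (top ord_max).
  by rewrite lev_top.
have := le_numerical_radius_comb levA hu u1 Mu y1; apply: le_trans.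
by apply: ler_sum => i _; rewrite ler_wpM2r ?mulr_ge0 ?ab.
Qed.

(** The last conclusion says, without the adjoint, that [A^*] sends [u i] to a multiple of [u i.+1];
    with the third it makes the span of the [u i] reducing. *)
Lemma block_shift_extremal_vectors :
  chain_prod A_ k <> 0 -> numerical_radius A = numerical_radius A'' ->
  exists u : nat -> 'cV[C]_(\sum_(i < k.+1) n_ i),
  [/\ forall i, (i <= k)%N -> homog (fun s => lev s) i (u i),
      forall i, (i <= k)%N -> euclid_norm (u i) = 1,
      forall i, (i < k)%N -> A *m u i.+1 = (min_modulus (A_ i))%:C%C *: u i &
      forall i v, (i < k)%N -> homog (fun s => lev s) i.+1 v ->
        inner (u i.+1) v = 0 -> inner (A *m v) (u i) = 0].
Proof.
move=> ch wA.
(* Some column of the product is nonzero; the descent starts at its index. *)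
have [t cht] : exists t, chain_prod A_ k *m delta_mx t 0 != 0 :> 'cV[C]_(n_ 0).
  apply: contra_notP ch => /forallNP h; apply/matrixP => s t.
  have /negP := h t; rewrite negbK => /eqP/colP/(_ s).
  by rewrite -colE !mxE.
have [|u [uk hu u1 Mu ab]] := @block_shift_descent (Rank (Ordinal (ltnSn k)) t).
  by rewrite /lev Rank1K.
pose b i := euclid_norm (A *m u i.+1).
have step i : (i < k)%N -> forall (hi : (i < k.+1)%N) (hi1 : (i.+1 < k.+1)%N),
    chain_prod A_ i.+1 *m block hi1 (u i.+1) =
    (b i)%:C%C *: (chain_prod A_ i *m block hi (u i)).
  move=> ik hi hi1; rewrite (chain_prod_mul_block A_ hi hi1 (hu _ ik)) -/A Mu //.
  by rewrite blockZ scalemxAr.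
(* Downward induction from level [k]: the product of the first [i] blocks does not kill [u i]. By
   [step], a zero [b i] would contradict this at [i.+1]. *)
have chu r : (r <= k)%N -> forall h : ((k - r) < k.+1)%N,
    chain_prod A_ (k - r)%N *m block h (u (k - r)%N) != 0.
  elim: r => [_|r IHr rk h].
    rewrite subn0 => h; suff -> : block h (u k) = delta_mx t 0 by [].
    rewrite (bool_irrelevance h (ltnSn k)); apply/colP => s; rewrite !mxE uk mxE.
    by rewrite -val_eqE eq_Rank eqxx.
  have h1 : ((k - r.+1).+1 < k.+1)%N by rewrite subnSK // ltnS leq_subr.
  have := step _ h1 h h1; move: (IHr (ltnW rk)); rewrite -(subnSK rk).
  move=> /(_ h1) + e; rewrite e => /eqP c0; apply/eqP => c1; apply: c0.
  by rewrite c1 scaler0.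
have b0 i : (i < k)%N -> 0 < b i.
  move=> ik; rewrite lt_def euclid_norm_ge0 andbT; apply/eqP => bi0.
  have := chu (k - i.+1)%N (leq_subr _ _); rewrite subKn // => c0.
  have := c0 ik; rewrite (step i ik (ltnW ik : (i < k.+1)%N) ik) bi0.
  by rewrite scale0r eqxx.
have [|y [y0 y1 wy]] :=
    @weighted_shift_maximizer R k (fun j => min_modulus (A_ j)).
  by move=> i; exact: min_modulus_ge0.
(* The sum with weights [b] is at most [w(A) = w(A'')], which is at most the sum with weights
   [m(A_i)], which is at most the sum with weights [b]. *)
have ext : \sum_(i < k) b i * (y i * y i.+1) = numerical_radius A.
  apply/eqP; rewrite eq_le (le_numerical_radius_comb levA hu u1 Mu y1) /=.
  rewrite wA (le_trans wy) //.
  by apply: ler_sum => i _; rewrite ler_wpM2r ?mulr_ge0 ?ab.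
exists u; split => // [i ik|i v ik hv uv].
  rewrite Mu //; congr (_%:C%C *: _).
  apply: (comb_weights levA hu u1 Mu y0 y1 b0 ext
    (a := fun j => min_modulus (A_ j))) => //.
  by rewrite wA.
exact: (comb_orthogonal levA hu u1 Mu y0 y1 b0 ext ik hv uv).
Qed.

(* The complement of the span of the [u i] has dimension [n_ i - 1] in level
   [i]; [g] lists the levels in which it is nonzero. *)
Lemma block_shift_decomposition (a : nat -> R)
    (u : nat -> 'cV[C]_(\sum_(i < k.+1) n_ i)) :
  (forall i, (i <= k)%N -> homog (fun s => lev s) i (u i)) ->
  (forall i, (i <= k)%N -> euclid_norm (u i) = 1) ->
  (forall i, (i < k)%N -> A *m u i.+1 = (a i)%:C%C *: u i) ->
  (forall i v, (i < k)%N -> homog (fun s => lev s) i.+1 v ->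
    inner (u i.+1) v = 0 -> inner (A *m v) (u i) = 0) ->
  exists (l : nat) (m_ : nat -> nat) (C_ : forall j, 'M[C]_(m_ j, m_ j.+1)),
    (forall i, (i < l)%N -> (1 <= m_ i)%N) /\
    unitarily_similar A (dsum_mx (weighted_shift k.+1 a) (block_shift l C_)).
Proof.
move=> hu u1 Au uperp.
have [i|i|f [fE ftop hf]] := homog_orthonormal_basis lev_top (u := u).
- by apply: hu; rewrite -ltnS.
- by apply: u1; rewrite -ltnS.
pose g := [seq i <- iota 0 k.+1 | (1 < n_ i)%N].
pose gi := nth 0%N g; pose l := size g; pose m_ i := (n_ (gi i)).-1.
have g_in i : (i < l)%N -> (gi i < k.+1)%N /\ (1 < n_ (gi i))%N.
  move=> il; have : gi i \in g by exact: mem_nth.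
  by rewrite mem_filter mem_iota => /andP[-> /andP[_]].
have g_sorted : sorted ltn g by apply/sorted_filter/iota_ltn_sorted/ltn_trans.
have g_mono i j : (i < j)%N -> (j < l)%N -> (gi i < gi j)%N.
  move=> ij jl; apply: (sorted_ltn_nth ltn_trans 0%N g_sorted) => //.
  by rewrite inE (ltn_trans ij).
have g_uniq : uniq g := sorted_uniq ltn_trans ltnn g_sorted.
(* [rho (i, j)] is the index at position [j.+1] of level [gi i], position 0 being taken by [u].
   Arbitrary values out of range make it total, which avoids dependent indices. *)
have /choice[rho rhoP] (p : nat * nat) : exists s : 'I_(\sum_(i < k.+1) n_ i),
    (p.1 < l)%N -> (p.2 < m_ p.1)%N ->
    lev s = gi p.1 :> nat /\ sig2 s = p.2.+1 :> nat.
  case: p => i j /=.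
  have [il|] := ltnP i l; last by move=> _; exists (top ord0).
  have [jm|] := ltnP j (m_ i); last by move=> _; exists (top ord0).
  have [gk gn] := g_in _ il.
  have jn : (j.+1 < n_ (Ordinal gk))%N by rewrite /= -ltn_predRL.
  exists (Rank (Ordinal gk) (Ordinal jn)) => _ _.
  by split; [rewrite /lev Rank1K|rewrite Rank2K].
(* The compression of [A] between consecutive listed levels; if these are not adjacent in the
   grading, the block is zero. *)
pose E j s t := inner (A *m f (rho (j.+1, t))) (f (rho (j, s))).
exists l, m_, (fun j => \matrix_(s, t) E j s t); split.
  by move=> i /g_in[_]; rewrite /m_ -ltn_predRL.
(* Reorders the adapted basis: first the [u i], then the complements level by level. *)
pose sg (x : 'I_(k.+1 + \sum_(i < l) m_ i)) := match split x with
  | inl i => top i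
  | inr r => rho (val (sig1 r), val (sig2 r))
  end.
have sgl i : sg (lshift _ i) = top i.
  rewrite /sg; case: splitP => j /= e; first by congr top; exact: val_inj.
  by have := ltn_ord i; rewrite e ltnNge leq_addr.
have sgr r : sg (rshift _ r) = rho (val (sig1 r), val (sig2 r)).
  rewrite /sg; case: splitP => j /= e.
    by have := ltn_ord j; rewrite -e ltnNge leq_addr.
  by move/addnI: e => /val_inj ->.
have rhoE (r : 'I_(\sum_(i < l) m_ i)) :
    lev (rho (val (sig1 r), val (sig2 r))) = gi (sig1 r) :> nat /\
    sig2 (rho (val (sig1 r), val (sig2 r))) = (sig2 r).+1 :> nat.
  by apply: rhoP => /=.
have sg_inj : injective sg.
  move=> x1 x2; case: (split_ordP x1) => i ->; case: (split_ordP x2) => j ->;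
    rewrite ?sgl ?sgr => e.
  - by congr lshift; rewrite -(lev_top i) e lev_top.
  - by have [_] := rhoE j; rewrite -e pos_top.
  - by have [_] := rhoE i; rewrite e pos_top.
  - have [e1 e2] := rhoE i; have [e3 e4] := rhoE j; congr rshift.
    rewrite e in e1 e2.
    have e5 : gi (sig1 j) = gi (sig1 i) by rewrite -e3.
    have [e6] : (sig2 j).+1 = (sig2 i).+1 by rewrite -e4.
    apply: tagnat_ext; last exact: esym.
    by move/eqP: e5; rewrite nth_uniq // => /eqP/val_inj.
have u_top i (ik : (i < k.+1)%N) : u i = f (top (Ordinal ik)) by rewrite ftop.
have f_top_rho i (r : 'I_(\sum_(i < l) m_ i)) :
    inner (f (top i)) (f (rho (val (sig1 r), val (sig2 r)))) = 0.
  rewrite fE; case: eqP => // e; have [_] := rhoE r.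
  by rewrite -e pos_top.
apply: (@unitarily_similar_orthonormal _ _ _ _ _ (f \o sg)).
(* Dimension count: one vector per level for [u], and [n_ i - 1] for the complement, which is 0 on
   the levels omitted from [g]. *)
- rewrite (eq_bigr (fun i : 'I_k.+1 => 1 + (n_ i).-1)%N) => [|i _]; last first.
    by rewrite add1n prednK // n_gt0.
  rewrite big_split /= sum1_card card_ord; congr (_ + _)%N.
  rewrite -(big_mkord xpredT (fun i => (n_ i).-1)) /index_iota subn0.
  rewrite (bigID (fun i => (1 < n_ i)%N)) /= addnC big1 ?add0n; last first.
    by move=> i; rewrite -leqNgt; case: (n_ i) => // -[].
  rewrite -big_filter -/g (big_nth 0%N) -/l.
  by rewrite big_mkord.
- by move=> s t; rewrite /= fE (inj_eq sg_inj).
move=> x1 x2 /=; case: (split_ordP x1) => i ->; case: (split_ordP x2) => j ->;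
  rewrite ?sgl ?sgr.
- rewrite block_mxEul mxE !ftop; case: j => -[|j] jk /=.
    by rewrite (homog0_mul levA (hu 0%N (leq0n k))) inner0l.
  rewrite (Au _ jk) innerZl (u_top _ (ltnW jk)) -ftop fE (inj_eq (can_inj lev_top)).
  by rewrite -val_eqE /= eqSS; case: (eqVneq j i) => [-> |_]; rewrite ?mulr1 ?mulr0.
(* [A] keeps the complement away from the [u i]: by [uperp] in the adjacent level, by degree in the
   others. *)
- rewrite block_mxEur mxE ftop; have [e1 _] := rhoE j.
  set v := f _; have hv : homog (fun s => lev s) (gi (sig1 j)) v.
    by rewrite -e1; exact: hf.
  have uv i' : (i' < k.+1)%N -> inner (u i') v = 0.
    by move=> ik; rewrite (u_top _ ik) f_top_rho.
  case: (gi (sig1 j)) hv (g_in _ (ltn_ord (sig1 j))).1 => [|q] hv qk.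
    by rewrite (homog0_mul levA hv) inner0l.
  have [<-|/eqP qi] := eqVneq q (i : nat); first by rewrite uperp // uv.
  by rewrite (inner_homog (homog_mul levA hv) (hu i _)) // -ltnS.
- rewrite block_mxEdl mxE ftop; case: j => -[|j] jk /=.
    by rewrite (homog0_mul levA (hu 0%N (leq0n k))) inner0l.
  by rewrite (Au _ jk) innerZl (u_top _ (ltnW jk)) f_top_rho mulr0.
- rewrite block_mxEdr block_shift_matrixE; case: eqP => [e|ne].
  by rewrite /E -e.
  have [e1 _] := rhoE i; have [e2 _] := rhoE j.
  have h1 := hf (rho (val (sig1 i), val (sig2 i))).
  have h2 := hf (rho (val (sig1 j), val (sig2 j))).
  rewrite e1 in h1; rewrite e2 in h2.
  case eg : (gi (sig1 j)) h2 => [|q] h2.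
    by rewrite (homog0_mul levA h2) inner0l.
  rewrite (inner_homog (homog_mul levA h2) h1) // => qi.
  (* Levels adjacent in the grading are consecutive in [g]: a listed level strictly between them
     would lie strictly between [q] and [q.+1]. *)
  have mono (s t : 'I_l) : (gi s < gi t)%N -> (s < t)%N.
    apply: contraLR; rewrite -!leqNgt leq_eqVlt => /predU1P[/val_inj -> //|ts].
    exact/ltnW/g_mono.
  have ij : (sig1 i < sig1 j)%N by apply: mono; rewrite eg qi.
  have i1j : ((sig1 i).+1 < sig1 j)%N.
    by rewrite ltn_neqAle ij andbT eq_sym; exact/eqP.
  have i1l := ltn_trans i1j (ltn_ord (sig1 j)).
  have g1 := g_mono _ _ (ltnSn (sig1 i)) i1l.
  have := leq_ltn_trans g1 (g_mono _ _ i1j (ltn_ord (sig1 j))).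
  by rewrite eg qi ltnn.
Qed.

End Decomposition.

(* In (b), [l = 0] is the case where the summand C is absent. *)
Theorem theorem3p1 (R : realType) (k : nat) (n_ : nat -> nat)
    (A_ : forall j : nat, 'M[R[i]]_(n_ j, n_ j.+1))
    (hk : (2 <= k)%N) (hn : forall i : nat, (i < k)%N -> (1 <= n_ i)%N) :
  let A := block_shift k A_ in
  let A'' := weighted_shift k (fun j => min_modulus (A_ j)) in
  numerical_radius A'' <= numerical_radius A
  /\ (chain_prod A_ k.-1 <> 0 ->
      (numerical_radius A = numerical_radius A'' <->
       exists (l : nat) (m_ : nat -> nat)
              (C_ : forall j : nat, 'M[R[i]]_(m_ j, m_ j.+1)),
         [/\ forall i : nat, (i < l)%N -> (1 <= m_ i)%N,
             unitarily_similar A (dsum_mx A'' (block_shift l C_))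
           & (0 < l)%N ->
             numerical_radius (block_shift l C_) <= numerical_radius A''])).
Proof.
case: k hk hn => // k _ hn A A''.
have wA := weighted_shift_le_block_shift A_ hn.
split=> // ch; split=> [eqw|[l [m_ [C_ [_ sim wC]]]]].
  have [u [hu u1 Au uperp]] := block_shift_extremal_vectors hn ch eqw.
  have [l [m_ [C_ [m0 sim]]]] := block_shift_decomposition hn hu u1 Au uperp.
  exists l, m_, C_; split => // _; rewrite -eqw.
  exact: numerical_radius_summand sim.
apply: le_anti; rewrite wA andbT; apply: numerical_radius_dsum sim _ => x.
(* For [l = 0] the vector [x] has no coordinates and its form is an empty sum; otherwise the bound
   on [w(C)] applies. *)
case: l C_ wC x => [|l] C_ wC x.
  rewrite /inner big1 ?(Normc.normc0 R) => [|[s hs] _]; last first.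
    by exfalso; move: hs; rewrite big_ord0.
  by rewrite mulr_ge0 ?numerical_radius_ge0 ?sqr_ge0.
apply: le_trans (numerical_radius_ub _ _) _.
by rewrite ler_wpM2r ?sqr_ge0 ?wC.
Qed.
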